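(* The problem $\textsc{Comp-Sub}(\mathcal{PM})$ can be solved in polynomial time on $P_5$-free graphs.
   Context: All graphs are finite, simple and undirected. $P_5$ is the path on five vertices; $P_5$-free means no induced $P_5$. $\textsc{Comp-Sub}(\mathcal{PM})$ is the decision problem: given a graph $G=(V,E)$, can $V$ be partitioned into $V_1,V_2$ such that $G[V_1]$ is isomorphic to the complement of $G[V_2]$ and the set of edges of $G$ between $V_1$ and $V_2$ is a perfect matching (every vertex is incident to exactly one such edge)? *)

(* Defs.v *)
From HB Require Import structures.
From mathcomp Require Import all_boot all_order all_algebra.

Set Implicit Arguments.
Unset Strict Implicit.
Unset Printing Implicit Defensive.

Record sgraph := SGraph {
  vertex :> finType;
  edge : rel vertex;
  edge_sym : symmetric edge;
  edge_irrefl : irreflexive edge }.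

Section Graphs.
Variable G : sgraph.

Section Induced.
Variable A : {set G}.

Definition induced_edge : rel {x : G | x \in A} :=
  fun x y => edge (val x) (val y).

Fact induced_edge_sym : symmetric induced_edge.
Proof. by move=> x y; apply: edge_sym. Qed.

Fact induced_edge_irrefl : irreflexive induced_edge.
Proof. by move=> x; apply: edge_irrefl. Qed.

Definition induced : sgraph := SGraph induced_edge_sym induced_edge_irrefl.

End Induced.

Definition compl_edge : rel G := fun x y => (x != y) && ~~ edge x y.

Fact compl_edge_sym : symmetric compl_edge.
Proof. by move=> x y; rewrite /compl_edge eq_sym edge_sym. Qed.

Fact compl_edge_irrefl : irreflexive compl_edge.
Proof. by move=> x; rewrite /compl_edge eqxx. Qed.

Definition complement : sgraph := SGraph compl_edge_sym compl_edge_irrefl.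

End Graphs.

Definition isomorphic (G H : sgraph) : Prop :=
  exists2 f : G -> H, bijective f & forall x y, edge (f x) (f y) = edge x y.

Section Path.
Variable n : nat.

Definition path_edge : rel 'I_n :=
  fun i j => (i.+1 == j :> nat) || (j.+1 == i :> nat).

Fact path_edge_sym : symmetric path_edge.
Proof. by move=> i j; rewrite /path_edge orbC. Qed.

Fact path_edge_irrefl : irreflexive path_edge.
Proof. by move=> i; rewrite /path_edge orbb gtn_eqF. Qed.

(* The path on n vertices (so n - 1 edges). *)
Definition path_graph : sgraph := SGraph path_edge_sym path_edge_irrefl.

End Path.

Definition induced_free (H G : sgraph) : Prop :=
  forall A : {set G}, ~ isomorphic (induced A) H.

Definition edges_between (G : sgraph) (A B : {set G}) : {set {set G}} :=
  [set [set x; y] | x in A, y in B & edge x y].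

Definition perfect_matching (G : sgraph) (M : {set {set G}}) : Prop :=
  forall x : G, #|[set e in M | x \in e]| = 1.

(* Neither part is required to be nonempty: the isomorphism forces
   #|V1| = #|V2|, so this only makes the graph with no vertex a yes-instance. *)
Definition comp_sub_PM (G : sgraph) : Prop :=
  exists V1 V2 : {set G},
    [/\ V1 :|: V2 = [set: G], V1 :&: V2 = set0,
        isomorphic (induced V1) (complement (induced V2))
      & perfect_matching (edges_between V1 V2)].

Variant move := MoveLeft | Stay | MoveRight.

Section Tape.
Variable A : Type.

(* A two-way infinite tape: None is the blank, lhs and rhs list the cells
   beyond the scanned one, nearest first, and all cells past their ends are
   blank. *)
Record tape := Tape {
  lhs : seq (option A);
  scanned : option A;
  rhs : seq (option A) }.

Definition blank_tape : tape := Tape [::] None [::].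

Definition input_tape (w : seq A) : tape :=
  let s := map Some w in Tape [::] (head None s) (behead s).

Definition write_move (am : option A * move) (t : tape) : tape :=
  let: (a, m) := am in
  match m with
  | MoveLeft => Tape (behead (lhs t)) (head None (lhs t)) (a :: rhs t)
  | Stay => Tape (lhs t) a (rhs t)
  | MoveRight => Tape (a :: lhs t) (head None (rhs t)) (behead (rhs t))
  end.

End Tape.

(* Deterministic Turing machines with input alphabet S and ntapes.+1 tapes.
   The tape alphabet consists of the blank (None), the input symbols (inl) and
   the auxiliary symbols (inr).  A state q is halting when verdict q = Some b,
   and b is then the answer. *)
Record turing_machine (S : finType) := TuringMachine {
  ntapes : nat;
  state : finType;
  aux : finType;
  start : state;
  verdict : state -> option bool;
  transition :
    state -> ntapes.+1.-tuple (option (S + aux)) ->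
    state * ntapes.+1.-tuple (option (S + aux) * move) }.

Section Run.
Variables (S : finType) (M : turing_machine S).

Record config := Config {
  cstate : state M;
  ctapes : (ntapes M).+1.-tuple (tape (S + aux M)) }.

Definition init (w : seq S) : config :=
  Config (start M)
    [tuple if i == ord0 then input_tape (map inl w) else blank_tape _
      | i < (ntapes M).+1].

Definition step (c : config) : config :=
  if verdict (cstate c) is Some _ then c
  else
    let: (q, acts) :=
      transition (cstate c) [tuple scanned (tnth (ctapes c) i) | i < _] in
    Config q [tuple write_move (tnth acts i) (tnth (ctapes c) i) | i < _].

(* Halting configurations are fixed by step, so this says that M halts on w
   after at most t steps, with answer b. *)
Definition answers_within (w : seq S) (t : nat) (b : bool) : Prop :=
  verdict (cstate (iter t step (init w))) = Some b.

End Run.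

(* The adjacency matrix, row by row: Some b is an entry and None ends a row.
   The vertex order is that of enum G; since G ranges over graphs on arbitrary
   finite types (in particular 'I_n), every adjacency matrix occurs. *)
Definition encode (G : sgraph) : seq (option bool) :=
  flatten [seq rcons [seq Some (edge x y) | y <- enum G] None | x <- enum G].

(* On graphs outside the class C nothing is required of the machine. *)
Definition poly_time_solvable_on (C P : sgraph -> Prop) : Prop :=
  exists (M : turing_machine (option bool)) (p : {poly nat}),
    forall G : sgraph, C G ->
      exists2 b : bool,
        answers_within M (encode G) p.[size (encode G)]%R b & P G <-> b.

(* Main.v *)
Require Import Defs.
From mathcomp Require Import all_boot all_order all_algebra.
From mathcomp Require Import zify.

Set Implicit Arguments.
Unset Strict Implicit.
Unset Printing Implicit Defensive.

(** The [P_5]-free yes-instances are exactly the cliques with one pendant vertex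
    attached to each vertex.  Let [m] be the matching between the parts [A] and
    [B].  An induced [P_4] in a part extends through [m] to an induced [P_5], so
    [G[A]] or its complement, isomorphic to [G[B]], has diameter at most 2; say
    that [G[A]] does.
    For distinct nonadjacent [x], [z] in [A], a common neighbour and [m x], [m z]
    would give an induced [P_5] unless [m x] and [m z] are adjacent; counting
    edges, [m] maps edges of [A] exactly to nonedges of [B].  If [x], [y] are
    adjacent in [A] then a vertex of [B] adjacent to [m x] but not to [m y] would
    again give an induced [P_5], so all vertices of [B] have the same neighbours
    in [B]; hence [B] has no edge and [A] is a clique.

    Such graphs are recognised in linear time: a second tape keeps, for each
    column [y] of the adjacency matrix, the numbers (capped at 2) of adjacent and
    nonadjacent vertices [x] of degree 1 and of degree different from 1.  On
    reading row [x] the machine stores its entries in the column cells and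
    computes the degree of [x], and it updates the cells on the way back. *)

(** * Reduction to coronas of cliques *)

Section Coronas.
Variable G : sgraph.
Implicit Types (A B : {set G}) (m : G -> G) (x y z : G).

Definition crossing A x y := edge x y && ((x \in A) != (y \in A)).

(** A perfect matching across the cut, stored as its partner function. The single equation gives
    existence and uniqueness of partners, and makes [m] an involution exchanging the two sides. *)
Definition cut_matching A m := forall x y, crossing A x y = (y == m x).

(** [A] is the clique; its complement consists of the pendant vertices. *)
Definition corona A m :=
  [/\ cut_matching A m, {in A &, forall x y, x != y -> edge x y}
    & {in ~: A &, forall x y, ~~ edge x y}].

Lemma crossing_sym A x y : crossing A x y = crossing A y x.
Proof. by rewrite /crossing edge_sym eq_sym. Qed.

Lemma crossingC A x y : crossing (~: A) x y = crossing A x y.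
Proof. by rewrite /crossing !inE; case: (x \in A) (y \in A) => [] []. Qed.

Lemma cut_matchingC A m : cut_matching A m -> cut_matching (~: A) m.
Proof. by move=> mA x y; rewrite crossingC mA. Qed.

Lemma cut_matchingP A :
  (forall x, exists y, crossing A x y) ->
  (forall x y z, crossing A x y -> crossing A x z -> y = z) ->
  exists m, cut_matching A m.
Proof.
move=> ex uq; exists (fun x => odflt x [pick y | crossing A x y]) => x y.
case: pickP => [z cz /=|none]; last by have [z] := ex x; rewrite none.
by apply/idP/eqP => [cy|->//]; apply: uq cy cz.
Qed.

Lemma set2_inj x y z : [set x; y] = [set x; z] -> y = z.
Proof.
move=> /setP e; have := e y; rewrite !inE eqxx orbT => /esym/orP[/eqP yx|/eqP//].
by have := e z; rewrite !inE eqxx orbT yx orbb => /eqP.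
Qed.

Lemma edges_betweenP A x y :
  ([set x; y] \in edges_between A (~: A)) = crossing A x y.
Proof.
apply/imset2P/idP => [[a b aA]|].
  rewrite !inE => /andP[bA ab] e.
  have cab : crossing A a b by rewrite /crossing ab aA (negPf bA).
  have : a \in [set x; y] by rewrite e !inE eqxx.
  rewrite !inE => /orP[] /eqP ax; rewrite ax in e cab.
    by rewrite (set2_inj e).
  by move: e; rewrite setUC => /set2_inj ->; rewrite crossing_sym.
case/andP => xy side; have [xA|xA] := boolP (x \in A).
  by exists x y => //; move: side; rewrite !inE xA xy; case: (y \in A).
exists y x; last by rewrite setUC.
  by move: side; rewrite (negPf xA); case: (y \in A).
by rewrite !inE xA edge_sym.
Qed.

Lemma perfect_matchingP A :
  perfect_matching (edges_between A (~: A)) <-> exists m, cut_matching A m.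
Proof.
split=> [pm|[m mA] x].
  apply: cut_matchingP => [x|x y z cy cz].
    have /eqP/cards1P[e /setP/(_ e)] := pm x.
    rewrite !inE eqxx => /andP[eM xe].
    have /imset2P[a b aA] := eM; rewrite inE => /andP[bA ab] eab.
    move: xe eM; rewrite eab !inE => /orP[] /eqP ->; rewrite edges_betweenP.
      by exists b.
    by exists a; rewrite crossing_sym.
  have /eqP/cards1P[e /setP he] := pm x.
  have := he [set x; y]; have := he [set x; z].
  rewrite !inE !edges_betweenP cy cz eqxx /= => /esym/eqP ez /esym/eqP ey.
  by apply: (@set2_inj x); rewrite ez ey.
apply/eqP/cards1P; exists [set x; m x]; apply/setP => e; rewrite !inE.
apply/andP/eqP => [[eM xe]|->]; last first.
  by rewrite edges_betweenP mA eqxx !inE eqxx.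
have /imset2P[a b _ _ eab] := eM; move: eM xe.
rewrite eab edges_betweenP !inE => cab /orP[] /eqP ->.
  by move: cab; rewrite mA => /eqP ->.
by move: cab; rewrite crossing_sym mA => /eqP ->; rewrite setUC.
Qed.

Section CutMatching.
Variables (A : {set G}) (m : G -> G).
Hypothesis mA : cut_matching A m.

Lemma cut_edge x : edge x (m x).
Proof. by have := mA x (m x); rewrite eqxx => /andP[]. Qed.

Lemma cut_side x : (m x \in A) = (x \notin A).
Proof.
have := mA x (m x); rewrite eqxx => /andP[_].
by case: (x \in A) (m x \in A) => [] [].
Qed.

Lemma cutK : involutive m.
Proof.
by move=> x; apply/esym/eqP; rewrite -mA crossing_sym mA.
Qed.

Lemma cut_nonedge x y : (x \in A) != (y \in A) -> y != m x -> edge x y = false.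
Proof. by move=> side; rewrite -mA /crossing side andbT => /negPf. Qed.

End CutMatching.

(** The matching [m] itself serves as the isomorphism, from the clique [A] to the complement of the
    independent set [~: A]. *)
Lemma corona_comp_sub A m : corona A m -> comp_sub_PM G.
Proof.
case=> mA cl ind; exists A, (~: A); split; rewrite ?setUCr ?setICr //; last first.
  by apply/perfect_matchingP; exists m.
have fA (u : induced A) : m (val u) \in ~: A.
  by rewrite inE (cut_side mA) negbK (valP u).
have gA (u : complement (induced (~: A))) : m (val u) \in A.
  by rewrite (cut_side mA); have := valP u; rewrite inE.
exists (fun u => Sub (m (val u)) (fA u)).
  exists (fun u => Sub (m (val u)) (gA u)) => u; apply: val_inj => /=;
  exact: (cutK mA).
move=> u v; rewrite /= /compl_edge /= /induced_edge /= -val_eqE /=.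
rewrite (inj_eq (inv_inj (cutK mA))) (negPf (ind _ _ _ _)) ?fA // andbT.
have [->|ne] := eqVneq (val u) (val v); first by rewrite edge_irrefl.
by rewrite cl ?(valP u) ?(valP v).
Qed.

Lemma path5_free (a b c d e : G) :
  induced_free (path_graph 5) G ->
  edge a b -> edge b c -> edge c d -> edge d e ->
  edge a c = false -> edge a d = false -> edge a e = false ->
  edge b d = false -> edge b e = false -> edge c e = false -> False.
Proof.
move=> free ab bc cd de ac ad ae bd be ce.
pose f (i : path_graph 5) := nth a [:: a; b; c; d; e] i.
have fE i j : edge (f i) (f j) = path_edge i j.
  case: i j => [[|[|[|[|[|//]]]]] hi] [[|[|[|[|[|//]]]]] hj];
    rewrite /f /path_edge /= ?edge_irrefl //;
    by rewrite edge_sym.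
(* Distinct vertices of $P_5$ have distinct neighbourhoods, so the adjacencies alone make [f]
   injective. *)
have f_inj : injective f.
  move=> i j eij; have E k : path_edge i k = path_edge j k by rewrite -!fE eij.
  apply: val_inj; move: (E (inord 0)) (E (inord 1)) (E (inord 2)).
  move: (E (inord 3)) (E (inord 4)).
  rewrite /path_edge !inordK // {eij E}.
  by case: i j => [[|[|[|[|[|//]]]]] hi] [[|[|[|[|[|//]]]]] hj].
pose A := [set f i | i in [set: 'I_5]].
have fin (i : path_graph 5) : f i \in A by apply: imset_f; rewrite inE.
have gin (u : induced A) : exists i, f i == val u.
  by have /imsetP[i _ ->] := valP u; exists i.
apply: (free A); exists (fun u => xchoose (gin u)).
  exists (fun i => Sub (f i) (fin i)) => [u|i].
    by apply: val_inj; rewrite /= (eqP (xchooseP (gin u))).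
  by apply: f_inj; rewrite (eqP (xchooseP (gin _))).
by move=> u v; rewrite /= -fE !(eqP (xchooseP (gin _))).
Qed.

End Coronas.

(** * Structure of the $P_5$-free yes-instances *)

Lemma isomorphic_complement_sym (G H : sgraph) :
  isomorphic G (complement H) -> isomorphic H (complement G).
Proof.
case=> f [g fK gK] fE; exists g; first by exists f.
move=> x y /=; rewrite /compl_edge -fE !gK /= /compl_edge (can_eq gK).
by have [->|] := eqVneq x y; rewrite ?edge_irrefl //= negbK.
Qed.

(** Replaces an isomorphism between subtypes by a function on all of [G], so that it can be combined
    with [m]. *)
Lemma isomorphic_complement_map (G : sgraph) (A B : {set G}) :
  isomorphic (induced A) (complement (induced B)) ->
  exists g : G -> G, [/\ {in A, forall x, g x \in B},
    {in B, forall y, exists2 x, x \in A & g x = y}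
  & {in A &, forall x y, edge (g x) (g y) = (x != y) && ~~ edge x y}].
Proof.
case/isomorphic_complement_sym=> f' [f f'K fK] f'E.
(* Outside [A] the value is an arbitrary default. *)
pose g x : G := if insub x is Some u then val (f u) else x.
have gE x (xA : x \in A) : g x = val (f (Sub x xA)) by rewrite /g insubT.
exists g; split.
- by move=> x xA; rewrite gE; apply: (valP (f _)).
- move=> y yB; pose u : {x | x \in A} := f' (Sub y yB).
  exists (val u); rewrite ?(valP u) // (gE _ (valP u)).
  by rewrite (_ : Sub _ _ = u) ?f'K //; apply: val_inj.
- move=> x y xA yA; rewrite !gE.
  have := f'E (f (Sub x xA)) (f (Sub y yA)).
  by rewrite !fK /= /compl_edge /= /induced_edge -val_eqE /= => ->.
Qed.

Section PathFree.
Variables (G : sgraph) (A : {set G}) (m : G -> G).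
Hypothesis free : induced_free (path_graph 5) G.
Hypothesis mA : cut_matching A m.

Definition diameter2 := {in A &, forall x z, x != z -> ~~ edge x z ->
  exists2 y, y \in A & edge x y && edge y z}.

(** The only neighbour of [m w] in [A] is [w], so [m w] prolongs an induced path [w x y z] to an
    induced $P_5$. *)
Lemma path4_free (w x y z : G) :
  w \in A -> x \in A -> y \in A -> z \in A ->
  edge w x -> edge x y -> edge y z ->
  edge w y = false -> edge w z = false -> edge x z = false -> False.
Proof.
move=> wA xA yA zA wx xy yz wy wz xz.
have N u : u \in A -> u != w -> edge (m w) u = false.
  move=> uA uw; apply: (cut_nonedge mA); first by rewrite (cut_side mA) wA uA.
  by rewrite (cutK mA).
apply: (path5_free free (a := m w) _ wx xy yz) => //.
- by rewrite edge_sym (cut_edge mA).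
- by apply: N xA _; apply: contraFneq wy => <-.
- by apply: N yA _; apply: contraFneq wz => <-.
- by apply: N zA _; apply: contraFneq xz => ->; rewrite edge_sym.
Qed.

(* Without a common neighbour of x and z, the ball of radius 2 around x is a
   union of components avoiding z. *)
Lemma diameter2_or_complement :
  diameter2 \/
  {in A &, forall u v, edge u v ->
     exists2 w, w \in A & [&& w != u, w != v, ~~ edge w u & ~~ edge w v]}.
Proof.
have [/forallP all_xz|] := boolP [forall x, forall z,
  [&& x \in A, z \in A, x != z & ~~ edge x z] ==>
  [exists y, [&& y \in A, edge x y & edge y z]]].
  left=> x z xA zA xz nxz; have /forallP/(_ z) := all_xz x.
  by rewrite xA zA xz nxz => /existsP[y /andP[yA]]; exists y.
rewrite negb_forall => /existsP[x]; rewrite negb_forall => /existsP[z].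
rewrite negb_imply => /andP[/and4P[xA zA xz nxz]].
rewrite negb_exists => /forallP none; right.
pose S := [set s in A | [|| s == x, edge x s |
   [exists t, [&& t \in A, edge x t & edge t s]]]].
have xS : x \in S by rewrite !inE xA eqxx.
have zS : z \notin S.
  rewrite !inE zA eq_sym (negPf xz) (negPf nxz) /= negb_exists.
  exact/forallP.
(* A vertex [v] reached only at distance 3 would end an induced $P_4$ [x t u v] inside [A]. *)
have closed u v : u \in S -> v \in A -> edge u v -> v \in S.
  rewrite !inE => /andP[uA uS] vA uv; rewrite vA /=.
  have [//|vx] := eqVneq v x; have [//|xv] /= := boolP (edge x v).
  apply/existsP; have [xu|xu] := boolP (edge x u); first by exists u; rewrite uA xu.
  move: uS; rewrite (negPf xu) /= => /orP[/eqP ux|/existsP[t /and3P[tA xt tu]]].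
    by move: xv; rewrite -ux uv.
  exists t; rewrite tA xt /=; apply/negPn/negP => /negPf tv.
  by apply: (path4_free xA tA uA vA xt tu uv); rewrite ?tv //; apply/negbTE.
(* An edge lies inside [S] or outside it; the common non-neighbour is [z] in the first case and [x]
   in the second. *)
move=> u v uA vA uv.
have uvS : (u \in S) = (v \in S).
  by apply/idP/idP => h; apply: closed h _ _ => //; rewrite edge_sym.
have sep s t : s \in S -> t \in A -> t \notin S -> (s != t) && ~~ edge s t.
  move=> sS tA tS; apply/andP; split; first by apply: contraNneq tS => <-.
  by apply: contra tS; apply: closed.
have [uS|uS] := boolP (u \in S).
  have vS : v \in S by rewrite -uvS.
  exists z => //; have /andP[uz eu] := sep _ _ uS zA zS.
  have /andP[vz ev] := sep _ _ vS zA zS.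
  by rewrite eq_sym uz eq_sym vz edge_sym eu edge_sym ev.
have vS : v \notin S by rewrite -uvS.
exists x => //; have /andP[xu eu] := sep _ _ xS uA uS.
by have /andP[-> ->] := sep _ _ xS vA vS; rewrite xu eu.
Qed.

(** Otherwise [m x], [x], [y], [z], [m z] is an induced $P_5$, where [y] is a common neighbour of
    [x] and [z]. *)
Lemma matched_edge (x z : G) : diameter2 -> x \in A -> z \in A ->
  x != z -> ~~ edge x z -> edge (m x) (m z).
Proof.
move=> diam xA zA xz nxz; apply/negPn/negP => /negPf nmm.
have [y yA /andP[xy yz]] := diam _ _ xA zA xz nxz.
have N u v : u \in A -> v \in A -> u != v -> edge (m u) v = false.
  move=> uA vA uv; apply: (cut_nonedge mA).
    by rewrite (cut_side mA) uA vA.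
  by rewrite (cutK mA) eq_sym.
have xy' : x != y by apply: contraTneq xy => ->; rewrite edge_irrefl.
have yz' : y != z by apply: contraTneq yz => ->; rewrite edge_irrefl.
apply: (path5_free free (a := m x) (e := m z) _ xy yz) => //.
- by rewrite edge_sym (cut_edge mA).
- exact: (cut_edge mA).
- exact: N.
- exact: N.
- exact/negbTE.
- by rewrite edge_sym N // eq_sym.
- by rewrite edge_sym N // eq_sym.
Qed.

(** Otherwise [m y], [y], [x], [m x], [w] is an induced $P_5$. *)
Lemma matched_twins (x y w : G) :
  x \in A -> y \in A -> w \notin A -> edge x y -> ~~ edge (m x) (m y) ->
  edge w (m x) -> edge w (m y).
Proof.
move=> xA yA wA xy nxy wx; apply/negPn/negP => /negPf nwy.
have N u v : u \in A -> v \notin A -> v != m u -> edge v u = false.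
  move=> uA vA uv; rewrite edge_sym; apply: (cut_nonedge mA) => //.
  by rewrite uA (negPf vA).
have mN u : u \in A -> m u \notin A by move=> uA; rewrite (cut_side mA) uA.
have xy' : x != y by apply: contraTneq xy => ->; rewrite edge_irrefl.
apply: (path5_free free (a := m y) (b := y) (c := x) (d := m x) (e := w)).
- by rewrite edge_sym (cut_edge mA).
- by rewrite edge_sym.
- exact: (cut_edge mA).
- by rewrite edge_sym.
- by apply: N => //; rewrite ?mN // (inj_eq (inv_inj (cutK mA))) eq_sym.
- by rewrite edge_sym; apply/negbTE.
- by rewrite edge_sym.
- by rewrite edge_sym; apply: N => //; rewrite ?mN // (inj_eq (inv_inj (cutK mA))).
- rewrite edge_sym; apply: N => //; apply: contraTneq wx => ->.
  by rewrite edge_sym.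
- rewrite edge_sym; apply: N => //; apply: contraTneq wx => ->.
  by rewrite edge_irrefl.
Qed.

Lemma diameter2_corona :
  diameter2 -> isomorphic (induced A) (complement (induced (~: A))) ->
  corona A m.
Proof.
move=> diam /isomorphic_complement_map[g [gB g_onto gE]].
have m_inj := inv_inj (cutK mA).
pose nonedges := [set p : G * G |
  [&& p.1 \in A, p.2 \in A, p.1 != p.2 & ~~ edge p.1 p.2]].
pose matched := [set p : G * G |
  [&& p.1 \in A, p.2 \in A & edge (m p.1) (m p.2)]].
have sub : nonedges \subset matched.
  apply/subsetP => p; rewrite !inE => /and4P[pA qA pq npq].
  by rewrite pA qA matched_edge.
(* Via [m], the set [matched] becomes a set of adjacent ordered pairs of [~: A], each of which is
   the image under [g] of a nonadjacent pair of [A]. With the inclusion above, the two sets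
   coincide. *)
have le : #|matched| <= #|nonedges|.
  have mm_inj : injective (fun p : G * G => (m p.1, m p.2)).
    by move=> [? ?] [? ?] [/m_inj -> /m_inj ->].
  rewrite -(card_imset _ mm_inj).
  apply: leq_trans (leq_imset_card (fun p => (g p.1, g p.2)) _).
  apply/subset_leq_card/subsetP => _ /imsetP[p /[!inE] /and3P[pA qA pq] ->].
  have [x xA gx] : exists2 x, x \in A & g x = m p.1.
    by apply: g_onto; rewrite inE (cut_side mA) pA.
  have [y yA gy] : exists2 y, y \in A & g y = m p.2.
    by apply: g_onto; rewrite inE (cut_side mA) qA.
  apply/imsetP; exists (x, y); last by rewrite /= gx gy.
  by rewrite inE /= xA yA -gE // gx gy.
have eqs : nonedges = matched by apply/eqP; rewrite eqEcard sub.
have mE : {in A &, forall x y, edge (m x) (m y) = (x != y) && ~~ edge x y}.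
  by move=> x y xA yA; have /setP/(_ (x, y)) := eqs; rewrite !inE /= xA yA.
have twins x y w : x \in A -> y \in A -> w \notin A -> edge x y ->
    edge w (m x) -> edge w (m y).
  move=> xA yA wA xy; apply: matched_twins => //.
  by rewrite mE // xy andbF.
(* If [m x] and [m y] were adjacent, [x] and [y] would have a common neighbour [z]; applying [twins]
   along [x z] and then [z y] would make [m y] adjacent to itself. *)
have ind : {in A &, forall x y, ~~ edge (m x) (m y)}.
  move=> x y xA yA; apply/negP => mxy.
  have := mxy; rewrite mE // => /andP[ne nxy].
  have [z zA /andP[xz zy]] := diam _ _ xA yA ne nxy.
  have yN : m y \notin A by rewrite (cut_side mA) yA.
  have : edge (m y) (m z) by apply: (twins x z) => //; rewrite edge_sym.
  by move/(twins z y) => /(_ zA yA yN zy); rewrite edge_irrefl.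
split=> // [x y xA yA xy|x y].
  by have := ind _ _ xA yA; rewrite mE // xy negbK.
rewrite !inE => xA yA; rewrite -(cutK mA x) -(cutK mA y).
by apply: ind; rewrite (cut_side mA).
Qed.

End PathFree.

Lemma path5_free_corona (G : sgraph) :
  induced_free (path_graph 5) G ->
  comp_sub_PM G <-> exists A m, @corona G A m.
Proof.
move=> free; split=> [[A [B [AB AIB iso pm]]]|[A [m]]];
  last exact: corona_comp_sub.
have BE : B = ~: A.
  apply/setP => x; rewrite inE; move/setP/(_ x): AB; move/setP/(_ x): AIB.
  by rewrite !inE; case: (x \in A) (x \in B) => [] [].
move: iso pm; rewrite BE {B AB AIB BE} => iso /perfect_matchingP[m mA].
have [diam|codiam] := diameter2_or_complement free mA.
  by exists A, m; apply: diameter2_corona.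
(* The sides change roles: [g] turns common non-neighbours of edges of [A] into common neighbours of
   nonadjacent pairs of [~: A]. *)
exists (~: A), m; apply: diameter2_corona => //.
- exact: cut_matchingC.
- have [g [gB g_onto gE]] := isomorphic_complement_map iso.
  move=> x z xA zA; have [u uA <-] := g_onto _ xA; have [v vA <-] := g_onto _ zA.
  move=> ne; have uv : u != v by apply: contraNneq ne => ->.
  rewrite gE // uv negbK => euv.
  have [w wA /and4P[wu wv nwu nwv]] := codiam _ _ uA vA euv.
  exists (g w); first exact: gB.
  by rewrite !gE // wv nwv eq_sym wu edge_sym nwu.
- by rewrite setCK; apply: isomorphic_complement_sym.
Qed.

(** * Neighbourhood profiles *)

(** The value 2 stands for two or more: counts are only compared with 0 and 1, and finitely many
    values let them fit into a tape symbol. *)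
Definition saturate (n : nat) : 'I_3 := inord (minn n 2).

Lemma saturateE n : saturate n = minn n 2 :> nat.
Proof. by rewrite inordK // ltnS geq_minr. Qed.

Lemma saturateD n k : saturate (saturate n + k) = saturate (n + k).
Proof. by apply: val_inj; rewrite /= !saturateE; lia. Qed.

Lemma foldl_saturate (T : Type) (a : pred T) n s :
  foldl (fun (r : 'I_3) x => saturate (r + a x)) (saturate n) s =
  saturate (n + count a s).
Proof.
elim: s n => [|x s IH] n /=; first by rewrite addn0.
by rewrite saturateD IH addnA.
Qed.

Definition row_degree (r : 'I_3) (e : bool) : 'I_3 := saturate (r + e).

(* At column y, index (e, l) counts the x with edge x y = e and
   (deg x == 1) = l. *)
Definition profile := {ffun bool * bool -> 'I_3}.

Definition profile0 : profile := [ffun => saturate 0].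

Definition profile_step (k : profile) (e : bool) (r : 'I_3) : profile :=
  [ffun t => saturate (k t + ((e, r == 1 :> nat) == t))].

(* In a corona of a clique with at least two vertices, the first disjunct holds
   at clique vertices and the second at pendant ones; the third is K_2. *)
Definition corona_profile (k : profile) : bool :=
  [|| [&& k (true, true) == 1 :> nat, k (false, false) == 1 :> nat
        & k (true, false) != 0 :> nat],
      (k (true, true) == 0 :> nat) && (k (true, false) == 1 :> nat)
    | [&& k (true, true) == 1 :> nat, k (true, false) == 0 :> nat,
          k (false, false) == 0 :> nat & k (false, true) == 1 :> nat]].

Section Profiles.
Variable G : sgraph.
Implicit Types (x y : G) (A : {set G}).

Definition leaf x := #|[set y | edge x y]| == 1.

(** The vertex [y] itself is counted, in [class y (false, leaf y)]. *)
Definition class y t := [set x | (edge x y, leaf x) == t].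

Lemma foldl_row_degree x :
  foldl row_degree (saturate 0) [seq edge x y | y <- enum G] =
  saturate #|[set y | edge x y]|.
Proof.
rewrite (foldl_saturate id) count_map cardsE cardE size_filter.
by rewrite enumT add0n; congr saturate; apply: eq_count.
Qed.

Lemma foldl_profile y t :
  foldl (fun k x => profile_step k (edge x y)
           (foldl row_degree (saturate 0) [seq edge x z | z <- enum G]))
    profile0 (enum G) t = saturate #|class y t|.
Proof.
have -> : #|class y t| = 0 + count (fun x => (edge x y, leaf x) == t) (enum G).
  by rewrite cardsE cardE size_filter enumT.
rewrite -foldl_saturate.
(* Each coordinate [t] of the profile evolves on its own as a capped counter, whatever its starting
   value. *)
have gen (s : seq G) (k : profile) (r : 'I_3) : k t = r ->
    foldl (fun k x => profile_step k (edge x y)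
             (foldl row_degree (saturate 0) [seq edge x z | z <- enum G]))
      k s t =
    foldl (fun (r : 'I_3) x => saturate (r + ((edge x y, leaf x) == t))) r s.
  elim: s k r => [|x s IH] k r //= krE.
  apply: IH; rewrite ffunE krE foldl_row_degree saturateE.
  by rewrite (_ : (_ == 1) = leaf x) // /leaf; lia.
by apply: gen; rewrite ffunE.
Qed.

Definition corona_at y :=
  [|| [&& #|class y (true, true)| == 1, #|class y (false, false)| == 1
        & #|class y (true, false)| != 0],
      (#|class y (true, true)| == 0) && (#|class y (true, false)| == 1)
    | [&& #|class y (true, true)| == 1, #|class y (true, false)| == 0,
          #|class y (false, false)| == 0 & #|class y (false, true)| == 1]].

Lemma corona_profileE (k : profile) y :
  (forall t, k t = saturate #|class y t|) -> corona_profile k = corona_at y.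
Proof.
move=> kE; rewrite /corona_profile /corona_at !kE !saturateE.
have E n : ((minn n 2 == 1) = (n == 1)) * ((minn n 2 == 0) = (n == 0)).
  by split; lia.
by rewrite !E.
Qed.

(** * Coronas characterised by the profiles of their vertices *)

Lemma cards_eq1 (S : {set G}) z : S =i [set z] -> #|S| == 1.
Proof. by move=> /setP ->; rewrite cards1. Qed.

Lemma cards_le1 (S : {set G}) x y : #|S| == 1 -> x \in S -> y \in S -> x = y.
Proof. by move=> /cards1P[z ->]; rewrite !inE => /eqP -> /eqP ->. Qed.

Lemma corona_corona_at A m y : corona A m -> corona_at y.
Proof.
case=> mA cl ind.
have out x z : x \notin A -> edge x z = (z == m x).
  move=> xA; rewrite -mA /crossing (negPf xA); case: (boolP (z \in A)) => zA.
    by rewrite andbT.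
  by rewrite andbF; apply/negbTE/ind; rewrite inE.
have inn x z : x \in A -> edge x z = (z == m x) || (z \in A) && (z != x).
  move=> xA; rewrite -mA /crossing xA; case: (boolP (z \in A)) => zA /=.
    rewrite andbF /=; have [->|ne] := eqVneq z x; first by rewrite edge_irrefl.
    by apply: cl => //; rewrite eq_sym.
  by rewrite andbT orbF.
have m_ne x : m x != x.
  by apply/eqP => e; have := cut_edge mA x; rewrite e edge_irrefl.
have leafN x : x \notin A -> leaf x.
  by move=> xA; apply: (@cards_eq1 _ (m x)) => z; rewrite !inE out.
(* The clique vertex of the matching edge at [y]. *)
pose c := if y \in A then y else m y.
have cA : c \in A by rewrite /c; case: ifPn => // yA; rewrite (cut_side mA).
have [/existsP[x /andP[xA xc]]|none] := boolP [exists x, (x \in A) && (x != c)].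
  (* Once the clique has a second vertex, each clique vertex has a neighbour [w] besides its
     partner, so the leaves are exactly the pendant vertices. *)
  have leafE z : leaf z = (z \notin A).
    have [zA|] := boolP (z \in A); last exact: leafN.
    have [w wA wz] : exists2 w, w \in A & w != z.
      have [->|ne] := eqVneq z x; last by exists x; rewrite // eq_sym.
      by exists c; rewrite // eq_sym.
    apply/negbTE/negP => one.
    have := @cards_le1 _ w (m z) one; rewrite !inE !inn // wA wz eqxx orbT.
    by move=> /(_ isT isT) e; move: wA; rewrite e (cut_side mA) zA.
  have [yA|yA] := boolP (y \in A).
    apply/or3P/Or31/and3P; split.
    - apply: (@cards_eq1 _ (m y)) => z; rewrite !inE xpair_eqE leafE eqb_id.
      rewrite edge_sym inn // eqb_id.
      have [->|_] /= := eqVneq z (m y); first by rewrite (cut_side mA) yA.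
      by case: (z \in A); rewrite ?andbF.
    - apply: (@cards_eq1 _ y) => z; rewrite !inE xpair_eqE leafE !eqbF_neg negbK.
      rewrite edge_sym inn //.
      have [->|ne] := eqVneq z y; first by rewrite andbF orbF eq_sym m_ne.
      by case: (z \in A); rewrite ?andbF ?orbT.
    - apply/eqP => /cards0_eq/setP/(_ x); rewrite !inE xpair_eqE leafE xA.
      rewrite edge_sym inn // xA; move: xc; rewrite /c yA => ->.
      by rewrite orbT.
  apply/or3P/Or32/andP; split.
    rewrite cards_eq0; apply/eqP/setP => z; rewrite !inE xpair_eqE leafE !eqb_id.
    rewrite edge_sym out //; have [->|//] := eqVneq z (m y).
    by rewrite (cut_side mA) yA.
  apply: (@cards_eq1 _ (m y)) => z; rewrite !inE xpair_eqE leafE eqb_id eqbF_neg.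
  rewrite negbK edge_sym out //; have [->|//] := eqVneq z (m y).
  by rewrite (cut_side mA) yA.
(* In the remaining case the clique is the single vertex [c] and the graph is $K_2$. *)
have AE z : z \in A -> z = c.
  move=> zA; apply/eqP/negPn/negP => zc; case/negP: none.
  by apply/existsP; exists z; rewrite zA.
have allE z : z != y -> z = m y.
  have [yA|yA] := boolP (y \in A); have [zA|zA] := boolP (z \in A).
  - by rewrite (AE z) // (AE y) // eqxx.
  - have := AE (m z); rewrite (cut_side mA) /c yA => /(_ zA) <-.
    by rewrite (cutK mA).
  - by rewrite (AE z) // /c (negPf yA).
  - have := AE (m z); rewrite (cut_side mA) /c (negPf yA) => /(_ zA).
    by move/(inv_inj (cutK mA)) ->; rewrite eqxx.
have leafT z : leaf z.
  have [zA|/leafN//] := boolP (z \in A).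
  apply: (@cards_eq1 _ (m z)) => w; rewrite !inE inn //.
  have [wA|wA] := boolP (w \in A); last by rewrite orbF.
  by rewrite (AE w) // (AE z) // eqxx orbF.
have edgeE z : edge z y = (z != y).
  have [->|/allE ->] := eqVneq z y; first exact: edge_irrefl.
  by rewrite edge_sym (cut_edge mA).
apply/or3P/Or33/and4P; split.
- apply: (@cards_eq1 _ (m y)) => z; rewrite !inE xpair_eqE leafT edgeE andbT eqb_id.
  by have [->|/allE ->] := eqVneq z y; rewrite ?eqxx // eq_sym (negPf (m_ne y)).
- by rewrite cards_eq0; apply/eqP/setP => z; rewrite !inE xpair_eqE leafT andbF.
- by rewrite cards_eq0; apply/eqP/setP => z; rewrite !inE xpair_eqE leafT andbF.
- apply: (@cards_eq1 _ y) => z; rewrite !inE xpair_eqE leafT edgeE andbT.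
  by rewrite eqbF_neg negbK.
Qed.

Lemma corona_at_corona : (forall y, corona_at y) -> exists A m, @corona G A m.
Proof.
move=> all_y.
(* If the third disjunct holds at some [y], the four classes leave room only for [y] and one
   neighbour [u], and [[set y]] is the clique. *)
have [/existsP[y /and4P[]]|] := boolP [exists y,
    [&& #|class y (true, true)| == 1, #|class y (true, false)| == 0,
        #|class y (false, false)| == 0 & #|class y (false, true)| == 1]].
  case/cards1P=> u /setP tt; rewrite !cards_eq0 => /eqP/setP tf /eqP/setP ff ft.
  have allE x : x = if x == y then y else u.
    have [//|xy] := eqVneq x y.
    have := tt x; have := tf x; have := ff x.
    rewrite !inE !xpair_eqE.
    have yin : y \in class y (false, true).
      have := ff y; rewrite !inE !xpair_eqE edge_irrefl eqxx /=.
      by case: (leaf y).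
    case: (boolP (leaf x)) => lx; case: (boolP (edge x y)) => xy' //=.
      by move=> _ _ /esym/eqP.
    move=> _ _ _; apply/eqP; case/eqP: xy; apply: (cards_le1 ft) => //.
    by rewrite inE lx (negPf xy').
  have uy : edge u y by have := tt u; rewrite !inE eqxx xpair_eqE eqb_id => /andP[].
  have une : u != y by apply: contraTneq uy => ->; rewrite edge_irrefl.
  exists [set y], (fun x => if x == y then u else y); split.
  - move=> x z; rewrite /crossing !inE (allE x) (allE z).
    have yu : (y == u) = false by rewrite eq_sym; apply: negbTE.
    case: (x == y); case: (z == y);
      by rewrite ?eqxx ?yu ?(negPf une) ?eqxx ?andbF ?uy // edge_sym uy.
  - by move=> x z; rewrite !inE => /eqP -> /eqP ->; rewrite eqxx.
  - move=> x z; rewrite !inE => /negPf xy /negPf zy.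
    by rewrite (allE x) (allE z) xy zy edge_irrefl.
rewrite negb_exists => /forallP none.
have degE y : #|[set x | edge y x]| =
    #|class y (true, true)| + #|class y (true, false)|.
  rewrite -(cardsID [set x | leaf x]); congr (_ + _); apply: eq_card => x;
  by rewrite !inE xpair_eqE edge_sym ?eqbF_neg !eqb_id // andbC.
(* The degree is at least 2 under the first disjunct and 1 under the second, so [leaf y] decides
   which one holds. *)
have at_y y : if leaf y then
    (#|class y (true, true)| == 0) && (#|class y (true, false)| == 1)
  else (#|class y (true, true)| == 1) && (#|class y (false, false)| == 1).
  have := all_y y; rewrite /corona_at (negPf (none y)) orbF /leaf degE.
  by case/orP => [/and3P[-> -> ne]|/andP[/eqP -> /eqP ->]] //;
    case: ifP => //; lia.
(* The clique must be the set of non-leaves; the partner of [y] is its unique neighbour of the other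
   kind. *)
pose A := [set y | ~~ leaf y].
have crossE y z : crossing A y z = (z \in class y (true, ~~ leaf y)).
  rewrite /crossing !inE xpair_eqE edge_sym eqb_id.
  by case: (leaf y) (leaf z) => [] [].
have one y : #|class y (true, ~~ leaf y)| == 1.
  by have := at_y y; case: (leaf y) => /andP[].
have [|y x z|m mA] := @cut_matchingP G A.
- by move=> y; have /cards1P[z /setP/(_ z)] := one y;
  rewrite inE eqxx -crossE; exists z.
- by rewrite !crossE; apply: cards_le1.
exists A, m; split=> // x y; rewrite !inE ?negbK => lx ly.
  (* Nonadjacent non-leaves [x] and [y] would both lie in [class y (false, false)], which has one
     element. *)
  move=> xy; apply/negPn/negP => nxy; case/eqP: xy.
  have := at_y y; rewrite (negPf ly) => /andP[_ ff].
  by apply: (cards_le1 ff); rewrite inE xpair_eqE ?edge_irrefl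
    ?(negPf lx) ?(negPf ly) ?(negPf nxy).
have := at_y y; rewrite ly cards_eq0 => /andP[/eqP/setP/(_ x) + _].
by rewrite !inE xpair_eqE lx andbT eqb_id => ->.
Qed.

End Profiles.

(** * The machine *)

Section Tapes.
Variable A : Type.
Implicit Types (X s : seq (option A)) (a : option A).

(** The head scans the first cell of [s], or a blank if [s] is empty. *)
Definition tape_at X s : tape A := Tape X (head None s) (behead s).

(* The head has just stepped left onto the first cell of [X]. *)
Definition tape_left X s : tape A := tape_at (behead X) (head None X :: s).

Lemma write_right a X s :
  write_move (a, MoveRight) (tape_at X s) = tape_at (a :: X) (behead s).
Proof. by []. Qed.

Lemma write_left a X s :
  write_move (a, MoveLeft) (tape_at X s) = tape_left X (a :: behead s).
Proof. by []. Qed.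

Lemma write_stay (t : tape A) : write_move (scanned t, Stay) t = t.
Proof. by case: t. Qed.

End Tapes.

Section ColumnMachine.
Variables (R K : finType) (r0 : R) (k0 : K).
Variables (row_step : R -> bool -> R) (col_step : K -> bool -> R -> K).
Variable good : K -> bool.

(** A cell of the second tape holds the state of its column and the entry last read there. *)
Let symbol : finType := (option bool + K * bool)%type.
(* [inl (true, r)]: reading a row; [inl (false, r)]: returning to its start;
   [inr None]: final check; [inr (Some b)]: halted with answer [b]. *)
Let cstates : finType := (bool * R + option bool)%type.

Definition cell_state (c : option symbol) : K :=
  if c is Some (inr (k, _)) then k else k0.

(** Blanks delimit the column cells: the return stops at the left one and the final check at the
    right one. During the return the first head waits at the start of the next row. *)
Definition column_transition (q : cstates) (a b : option symbol) :
    cstates * (option symbol * move) * (option symbol * move) :=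
  match q with
  | inl (true, r) =>
    match a with
    | Some (inl (Some e)) =>
        (inl (true, row_step r e), (a, MoveRight),
         (Some (inr (cell_state b, e)), MoveRight))
    | Some (inl None) => (inl (false, r), (a, MoveRight), (b, MoveLeft))
    | _ => (inr None, (a, Stay), (b, Stay))
    end
  | inl (false, r) =>
    match b with
    | Some (inr (k, e)) =>
        (inl (false, r), (a, Stay),
         (Some (inr (col_step k e r, e)), MoveLeft))
    | _ => (inl (true, r0), (a, Stay), (b, MoveRight))
    end
  | inr _ =>
    match b with
    | Some (inr (k, _)) =>
        (if good k then inr None else inr (Some false),
         (a, Stay), (b, MoveRight))
    | _ => (inr (Some true), (a, Stay), (b, Stay))
    end
  end.

Definition column_machine : turing_machine (option bool) :=
  @TuringMachine (option bool) 1 cstates (K * bool)%type (inl (true, r0))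
    (fun q => if q is inr o then o else None)
    (fun q ab =>
       let: (q', x, y) :=
         column_transition q (tnth ab ord0) (tnth ab (lift ord0 ord0)) in
       (q', [tuple x; y])).

Definition conf (q : cstates) (t u : tape symbol) : config column_machine :=
  @Config _ column_machine q [tuple t; u].

Lemma step_conf q t u :
  (if q is inr (Some _) then false else true) ->
  step (conf q t u) =
  let: (q', x, y) := column_transition q (scanned t) (scanned u) in
  conf q' (write_move x t) (write_move y u).
Proof.
move=> live; rewrite /step.
have -> : verdict (cstate (conf q t u)) = None.
  by case: q live => [|[]].
rewrite /= !tnth_mktuple /= !(tnth_nth t) /=.
case: column_transition => [[q' x] y]; congr Config.
apply: eq_from_tnth => i; rewrite tnth_mktuple !(tnth_nth t) /=.
by rewrite (tnth_nth x); case: i => [[|[|]]].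
Qed.

Definition entry (e : bool) : option symbol := Some (inl (Some e)).
Definition row_end : option symbol := Some (inl None).
Definition cell (c : K * bool) : option symbol := Some (inr c).

(** * Runs of the machine *)

(** The old states are kept and the old entries overwritten; a blank cell counts as a column in
    state [k0], as happens on the first row. *)
Fixpoint read_cells (s : seq (option symbol)) (es : seq bool) :=
  if es is e :: es' then
    (cell_state (head None s), e) :: read_cells (behead s) es'
  else [::].

Lemma read_cells_nil es :
  read_cells [::] es = zip (nseq (size es) k0) es.
Proof. by elim: es => //= e es ->. Qed.

Lemma read_cells_cat cs t es :
  size cs = size es -> read_cells (map cell cs ++ t) es = zip (unzip1 cs) es.
Proof.
by elim: es cs => [|e es IH] [|[k e'] cs] //= [sz]; rewrite IH.
Qed.

Lemma size_read_cells s es : size (read_cells s es) = size es.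
Proof. by elim: es s => //= e es IH s; rewrite IH. Qed.

Lemma run_forward es r U u L s :
  iter (size es) (@step _ column_machine)
    (conf (inl (true, r)) (tape_at U (map entry es ++ u)) (tape_at L s)) =
  conf (inl (true, foldl row_step r es)) (tape_at (rev (map entry es) ++ U) u)
    (tape_at (rev (map cell (read_cells s es)) ++ L) (drop (size es) s)).
Proof.
elim: es r U L s => [|e es IH] r U L s; first by rewrite /= drop0.
rewrite [size _]/= iterSr step_conf // [column_transition _ _ _]/=.
lazy beta iota.
rewrite !write_right IH !map_cons !rev_cons !cat_rcons.
by congr (conf _ _ (tape_at _ _)); case: s => //=; rewrite drop_nil.
Qed.

Lemma run_backward ds r t L s :
  iter (size ds) (@step _ column_machine)
    (conf (inl (false, r)) t (tape_left (map cell ds ++ L) s)) =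
  conf (inl (false, r)) t
    (tape_left L
       (map cell [seq (col_step c.1 c.2 r, c.2) | c <- rev ds] ++ s)).
Proof.
elim: ds s => [//|[k e] ds IH] s.
rewrite [size _]/= iterSr step_conf // [column_transition _ _ _]/=.
lazy beta iota.
rewrite write_left [behead _]/= [behead _]/= write_stay.
by rewrite IH rev_cons !map_rcons cat_rcons.
Qed.

(** The steps are [size es] forward, one at the row end, [size es] back and one to turn at the left
    blank. The hypotheses on [L] and [s] cover both the untouched second tape and one with explicit
    blanks around its cells. *)
Lemma run_row es U u L s :
  head None L = None -> behead L = [::] ->
  head None (drop (size es) s) = None -> behead (drop (size es) s) = [::] ->
  iter (size es + (size es).+2) (@step _ column_machine)
    (conf (inl (true, r0)) (tape_at U (rcons (map entry es) row_end ++ u))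
       (tape_at L s)) =
  conf (inl (true, r0))
    (tape_at (row_end :: rev (map entry es) ++ U) u)
    (tape_at [:: None]
       (map cell [seq (col_step c.1 c.2 (foldl row_step r0 es), c.2)
                 | c <- read_cells s es] ++ [:: None])).
Proof.
move=> hL bL hs bs; rewrite addnC iterD cat_rcons run_forward.
rewrite iterSr step_conf // [column_transition _ _ _]/=.
lazy beta iota.
rewrite write_right write_left.
rewrite iterS -(map_rev cell) bs hs.
rewrite -[X in iter X](size_read_cells s) -(size_rev (read_cells s es)).
rewrite run_backward step_conf // [scanned (tape_left _ _)]/= hL.
rewrite [column_transition _ _ _]/=.
lazy beta iota.
rewrite /tape_left bL write_right.
by rewrite revK.
Qed.

Definition next_states ks es :=
  [seq col_step c.1 c.2 (foldl row_step r0 es) | c <- zip ks es].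

Lemma run_rows n rows U cs :
  size cs = n -> (forall es, es \in rows -> size es = n) ->
  exists U' cs',
    iter (size rows * (n + n.+2)) (@step _ column_machine)
      (conf (inl (true, r0))
         (tape_at U (flatten [seq rcons (map entry es) row_end | es <- rows]))
         (tape_at [:: None] (map cell cs ++ [:: None]))) =
    conf (inl (true, r0)) (tape_at U' [::])
      (tape_at [:: None] (map cell cs' ++ [:: None])) /\
    unzip1 cs' = foldl next_states (unzip1 cs) rows.
Proof.
elim: rows U cs => [|es rows IH] U cs szc szr; first by exists U, cs.
have sze : size es = n by apply: szr; rewrite mem_head.
rewrite [size _]/= mulSnr iterD.
set s := map cell cs ++ _.
have dr : drop n s = [:: None].
  by rewrite /s drop_cat size_map szc ltnn subnn.
have run1 U1 u := @run_row es U1 u [:: None] s erefl erefl.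
rewrite sze dr in run1; rewrite [flatten _]/= run1 //.
rewrite /s read_cells_cat ?szc ?sze //.
set cs1 := map _ (zip _ _).
have [||U' [cs' [-> cs'E]]] := IH (row_end :: rev (map entry es) ++ U) cs1.
- by rewrite size_map size_zip size_map szc sze minnn.
- by move=> es' h; apply: szr; rewrite inE h orbT.
by exists U', cs'; split=> //; rewrite cs'E /= /cs1 /unzip1 -map_comp.
Qed.

Lemma run_check cs t L s :
  head None s = None -> exists u v,
  iter (size cs).+1 (@step _ column_machine)
    (conf (inr None) t (tape_at L (map cell cs ++ s))) =
  conf (inr (Some (all good (unzip1 cs)))) u v.
Proof.
move=> hs; elim: cs L => [|[k e] cs IH] L.
  by rewrite iterS step_conf //= hs /=; eexists _, _.
rewrite [size _]/= iterSr step_conf // [column_transition _ _ _]/=.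
lazy beta iota.
rewrite write_right [behead _]/= [all _ _]/=.
case: (good k); first by rewrite write_stay; apply: IH.
(* After a rejection the configuration stays fixed for the remaining steps. *)
elim: (size cs).+1 => [|i [u [v h]]]; first by eexists _, _.
by exists u, v; rewrite iterS h.
Qed.

Lemma size_rows n (rows : seq (seq bool)) :
  (forall es, es \in rows -> size es = n) ->
  size (flatten [seq rcons (map Some es) None | es <- rows]) = size rows * n.+1.
Proof.
elim: rows => //= es l IH szr.
rewrite size_cat size_rcons size_map szr ?mem_head // IH ?mulSn //.
by move=> es' h; apply: szr; rewrite inE h orbT.
Qed.

(** The [n] rows cost $2n+2$ steps each and the check $n+2$, in total at most $3n(n+1)+2$, where
    $n(n+1)$ is the input length. *)
Lemma column_machine_answers n rows
    (w := flatten [seq rcons (map Some es) None | es <- rows]) :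
  size rows = n -> (forall es, es \in rows -> size es = n) ->
  answers_within column_machine w (3 * size w + 2)
    (all good (foldl next_states (nseq n k0) rows)).
Proof.
move=> szn szr; rewrite /answers_within.
have halt i j q t u b :
    iter i (@step _ column_machine) q = conf (inr (Some b)) t u ->
    i <= j -> verdict (cstate (iter j (@step _ column_machine) q)) = Some b.
  move=> h le_ij; rewrite -(subnK le_ij) iterD h.
  by elim: (j - i) => // l IHl; rewrite iterS /step IHl.
have szw : size w = n * n.+1.
  by rewrite /w (size_rows szr) szn.
have ini : init column_machine w = conf (inl (true, r0))
  (tape_at [::] (flatten [seq rcons (map entry es) row_end | es <- rows]))
  (tape_at [::] [::]).
  rewrite /init; congr Config; apply: eq_from_tnth => i.
  rewrite tnth_mktuple (tnth_nth (blank_tape _)).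
  case: i => [[|[|//]]] //= _; rewrite /input_tape -map_comp map_flatten -map_comp.
  set s1 := flatten _; set s2 := flatten _.
  suff -> : s1 = s2 by [].
  by congr flatten; apply: eq_map => es; rewrite /= map_rcons -map_comp.
have checked L U cs s : size cs = n -> head None s = None -> exists u v,
    iter n.+2 (@step _ column_machine) (conf (inl (true, r0)) (tape_at U [::])
      (tape_at L (map cell cs ++ s))) =
    conf (inr (Some (all good (unzip1 cs)))) u v.
  move=> szc hs; rewrite iterSr step_conf // [column_transition _ _ _]/=.
  lazy beta iota.
  rewrite -szc.
  exact: run_check.
rewrite ini szw.
(* The first row is run separately, since the second tape is still entirely blank and not yet of the
   form that [run_rows] maintains. *)
case: rows szn szr {w szw ini} => [|es rows] szn szr.
  have [|//|u [v h]] := @checked [::] [::] [::] [::]; first by rewrite -szn.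
  by rewrite -szn in h *; apply: halt h _.
have sze : size es = n by apply: szr; rewrite mem_head.
pose cs := [seq (col_step c.1 c.2 (foldl row_step r0 es), c.2)
           | c <- read_cells [::] es].
have szc : size cs = n by rewrite size_map size_read_cells.
have ucs : unzip1 cs = next_states (nseq n k0) es.
  by rewrite /cs read_cells_nil sze /unzip1 -map_comp.
have [||U' [cs' [h1 h2]]] := @run_rows n rows
  (row_end :: rev (map entry es) ++ [::]) cs.
- by [].
- by move=> es' h; apply: szr; rewrite inE h orbT.
have szc' : size cs' = n.
  rewrite -(size_map fst) -/(unzip1 cs') h2 ucs.
  have : size (next_states (nseq n k0) es) = n.
    by rewrite -ucs size_map.
  move: (next_states _ _) => ks.
  have : forall es', es' \in rows -> size es' = n.
    by move=> es' h; apply: szr; rewrite inE h orbT.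
  elim: (rows) ks => //= es' l IH ks szl szk; apply: IH.
    by move=> e h; apply: szl; rewrite inE h orbT.
  by rewrite size_map size_zip szk szl ?mem_head ?minnn.
have [u [v h3]] := checked [:: None] U' cs' [:: None] szc' erefl.
rewrite h2 ucs in h3.
apply: (halt (n.+2 + (size rows * (n + n.+2) + (n + n.+2))) _ _ u v); last first.
  by move: szn => /=; nia.
have run1 U1 u := @run_row es U1 u [::] [::] erefl erefl.
rewrite sze in run1.
rewrite iterD [iter (_ * _ + _) _ _]iterD [flatten _]/= run1 // h1.
exact: h3.
Qed.

End ColumnMachine.

(** * Correctness on adjacency matrices *)

(** Columns do not interact except through the row summary, so processing the matrix row by row
    amounts to an independent fold in each column. *)
Lemma foldl_next_states (R K : finType) (T : Type) (r0 : R) (row_step : R -> bool -> R)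
    (col_step : K -> bool -> R -> K) (e : T -> T -> bool) (s t : seq T)
    (k : T -> K) :
  foldl (next_states r0 row_step col_step) [seq k y | y <- t]
    [seq [seq e x y | y <- t] | x <- s] =
  [seq foldl (fun k x => col_step k (e x y)
                (foldl row_step r0 [seq e x z | z <- t])) (k y) s | y <- t].
Proof.
elim: s k => [|x s IH] k //=; rewrite -IH; congr foldl.
by rewrite /next_states zip_map -map_comp.
Qed.

Theorem theorem3 :
  poly_time_solvable_on (fun G : sgraph => induced_free (path_graph 5) G)
    comp_sub_PM.
Proof.
exists (column_machine (saturate 0) profile0 row_degree profile_step
          corona_profile).
exists (3%:P * 'X + 2%:P)%R => G free.
pose rows := [seq [seq edge x y | y <- enum G] | x <- enum G].
have encE : encode G = flatten [seq rcons (map Some es) None | es <- rows].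
  rewrite /encode /rows -map_comp; congr flatten; apply: eq_map => x /=.
  by rewrite -map_comp.
have szr es : es \in rows -> size es = #|G|.
  by case/mapP=> x _ ->; rewrite size_map cardE.
have nseqE : nseq #|G| profile0 = [seq profile0 | _ <- enum G].
  by rewrite cardE; elim: (enum G) => //= _ s ->.
(* The answer [b] is left open and fixed by the run of the machine: whether every final column
   profile passes [corona_profile]. *)
eexists.
  rewrite encE hornerD hornerMX !hornerC.
  by apply: column_machine_answers szr; rewrite size_map cardE.
rewrite path5_free_corona // nseqE foldl_next_states all_map.
split=> [[A [m cor]]|/allP all_y].
  apply/allP => y _ /=; rewrite (corona_profileE (foldl_profile y)).
  exact: corona_corona_at cor.
apply: corona_at_corona => y.
rewrite -(corona_profileE (foldl_profile y)).
by apply: all_y; rewrite mem_enum.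
Qed.
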